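(* Let $N\ge1$, let $a_n<b_n$ be real numbers for $1\le n\le N^2$, let $L=\sup_n(b_n-a_n)$, let $\boldsymbol A$ be the $(2N+1)\times N^2$ matrix of the transportation problem with one cost constraint, and let $K=2N+1$. For $\boldsymbol\lambda\in\mathbb R^K$ set $\boldsymbol x^*(\boldsymbol\lambda)=\boldsymbol\xi(\boldsymbol A^t\boldsymbol\lambda)$. Then for every $\boldsymbol\lambda\in\mathbb R^K$, $\boldsymbol x^*(\boldsymbol\lambda)$ is a solution of the problem of finding $\boldsymbol x\in\prod_{n=1}^{N^2}[a_n,b_n]$ such that $\boldsymbol A\boldsymbol x=\boldsymbol y$ with data vector $\boldsymbol y=\boldsymbol A\boldsymbol\xi(\boldsymbol A^t\boldsymbol\lambda)$. Moreover, for all $\boldsymbol\lambda(1),\boldsymbol\lambda(2)\in\mathbb R^K$, $$\|\boldsymbol x^*(\boldsymbol\lambda(1))-\boldsymbol x^*(\boldsymbol\lambda(2))\|_2\le\frac L2\,d_M(\boldsymbol A^t\boldsymbol\lambda(1),\boldsymbol A^t\boldsymbol\lambda(2)),$$ $$\frac1N\|\boldsymbol x^*(\boldsymbol\lambda(1))-\boldsymbol x^*(\boldsymbol\lambda(2))\|_1\le\frac L2\,d_M(\boldsymbol A^t\boldsymbol\lambda(1),\boldsymbol A^t\boldsymbol\lambda(2)),$$ $$\sup_n|x_n^*(\boldsymbol\lambda(1))-x_n^*(\boldsymbol\lambda(2))|\le\frac L2\,\sup_n\big|h_n\big((\boldsymbol A^t\boldsymbol\lambda(1))_n\big)-h_n\big((\boldsymbol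 A^t\boldsymbol\lambda(2))_n\big)\big|.$$
   Context: The matrix $\boldsymbol A$ is obtained as follows. Pairs $(i,j)\in\{1,\dots,N\}^2$ are identified with $n=(i-1)N+j\in\{1,\dots,N^2\}$. $\boldsymbol C$ is the $2N\times N^2$ marginal matrix given by $(\boldsymbol C\boldsymbol x)_k=\sum_{j=1}^N x_{(k-1)N+j}$ and $(\boldsymbol C\boldsymbol x)_{N+k}=\sum_{j=1}^N x_{(j-1)N+k}$ for $1\le k\le N$. Given a cost vector $\boldsymbol W\in\mathbb R^{N^2}$, $\boldsymbol A$ is $\boldsymbol C$ with $\boldsymbol W^t$ added as its last row. For $1\le n\le N^2$ and $\tau\in\mathbb R$ put $$\xi_n(\tau)=\frac{a_ne^{-a_n\tau}+b_ne^{-b_n\tau}}{e^{-a_n\tau}+e^{-b_n\tau}},\qquad h_n(\tau)=2\arctan\big(e^{(b_n-a_n)\tau/2}\big),$$ and $\boldsymbol\xi(\boldsymbol\tau)=(\xi_n(\tau_n))_n$ for $\boldsymbol\tau\in\mathbb R^{N^2}$. For $\boldsymbol\tau,\boldsymbol\sigma\in\mathbb R^{N^2}$, $$d_M(\boldsymbol\tau,\boldsymbol\sigma)=\Big(\sum_{n=1}^{N^2}\big(h_n(\tau_n)-h_n(\sigma_n)\big)^2\Big)^{1/2},$$ which is the geodesic distance of the Hessian metric of $M(\boldsymbol\tau)=\sum_n\ln(e^{-a_n\tau_n}+e^{-b_n\tau_n})$. $\|\cdot\|_1$, $\|\cdot\|_2$ are the $\ell^1$ and $\ell^2$ norms on $\mathbb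 R^{N^2}$. *)

(* Defs.v *)
From mathcomp Require Import all_boot all_order all_algebra.
From mathcomp Require Import all_classical all_reals all_analysis.

Set Implicit Arguments.
Unset Strict Implicit.
Unset Printing Implicit Defensive.

Import Order.TTheory GRing.Theory Num.Theory.

Local Open Scope ring_scope.

(* The column index is 0-based: n = i * N + j encodes the pair (i, j), so that
   i = n %/ N and j = n %% N. *)
Definition marginal_mx (R : realType) (N : nat) : 'M[R]_(2 * N, N ^ 2) :=
  \matrix_(r, n) (if (r < N)%N then (n %/ N == r)%N else (n %% N == r - N)%N)%:R.

Definition transport_mx (R : realType) (N : nat) (W : 'cV[R]_(N ^ 2)) :
    'M[R]_(2 * N + 1, N ^ 2) :=
  col_mx (marginal_mx R N) W^T.

Definition xi (R : realType) (a b tau : R) : R :=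
  (a * expR (- a * tau) + b * expR (- b * tau)) /
  (expR (- a * tau) + expR (- b * tau)).

Definition xi_vec (R : realType) (m : nat) (a b : 'I_m -> R)
    (tau : 'cV[R]_m) : 'cV[R]_m :=
  \col_n xi (a n) (b n) (tau n 0).

Definition h (R : realType) (a b tau : R) : R :=
  2 * atan (expR ((b - a) * tau / 2)).

Definition dM (R : realType) (m : nat) (a b : 'I_m -> R)
    (tau sigma : 'cV[R]_m) : R :=
  Num.sqrt (\sum_n (h (a n) (b n) (tau n 0) - h (a n) (b n) (sigma n 0)) ^+ 2).

(* The library norm on matrices is the sup norm. *)
Definition l1norm (R : realType) (m : nat) (x : 'cV[R]_m) : R :=
  \sum_n `|x n 0|.

Definition l2norm (R : realType) (m : nat) (x : 'cV[R]_m) : R :=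
  Num.sqrt (\sum_n x n 0 ^+ 2).

Definition box_solution (R : realType) (k m : nat) (A : 'M[R]_(k, m))
    (a b : 'I_m -> R) (y : 'cV[R]_k) (x : 'cV[R]_m) : Prop :=
  (forall n, x n 0 \in `[a n, b n]) /\ A *m x = y.

Definition xstar (R : realType) (k m : nat) (A : 'M[R]_(k, m))
    (a b : 'I_m -> R) (lambda : 'cV[R]_k) : 'cV[R]_m :=
  xi_vec a b (A^T *m lambda).

Lemma pair_index_subproof (N : nat) (i j : 'I_N) : (i * N + j < N ^ 2)%N.
Proof.
apply: (@leq_trans (i.+1 * N)); first by rewrite mulSn addnC ltn_add2r.
by rewrite -mulnn leq_mul2r ltn_ord orbT.
Qed.

Definition pair_index (N : nat) (i j : 'I_N) : 'I_(N ^ 2) :=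
  Ordinal (pair_index_subproof i j).

Lemma sum_pair_index (R : realType) (N : nat) (F : 'I_(N ^ 2) -> R) :
  \sum_n F n = \sum_(i < N) \sum_(j < N) F (pair_index i j).
Proof.
rewrite pair_big /= (reindex (fun p : 'I_N * 'I_N => pair_index p.1 p.2)) //=.
apply: onW_bij; apply: inj_card_bij; last by rewrite card_prod !card_ord mulnn.
move=> [i j] [i' j'] /(congr1 val) /= e.
have N0 : (0 < N)%N by apply: leq_ltn_trans (ltn_ord i).
have := congr1 (fun x => x %/ N)%N e; have := congr1 (fun x => x %% N)%N e.
rewrite !modnMDl !divnMDl // !modn_small // !divn_small // !addn0.
by move=> /val_inj -> /val_inj ->.
Qed.

Lemma marginal_mx_row (R : realType) (N : nat) (x : 'cV[R]_(N ^ 2))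
    (k : 'I_N) (r : 'I_(2 * N)) : r = k :> nat ->
  (marginal_mx R N *m x) r 0 = \sum_(j < N) x (pair_index k j) 0.
Proof.
move=> rk; rewrite mxE sum_pair_index (bigD1 k) //= [X in _ + X]big1 ?addr0.
  apply: eq_bigr => j _; rewrite mxE rk ltn_ord /= divnMDl ?divn_small //.
    by rewrite addn0 eqxx mul1r.
  by apply: leq_ltn_trans (ltn_ord k).
move=> i ik; apply: big1 => j _; rewrite mxE rk ltn_ord /= divnMDl.
  by rewrite divn_small // addn0 (negbTE (ik : (i : nat) != k)) mul0r.
by apply: leq_ltn_trans (ltn_ord k).
Qed.

Lemma marginal_mx_col (R : realType) (N : nat) (x : 'cV[R]_(N ^ 2))
    (k : 'I_N) (r : 'I_(2 * N)) : r = (N + k)%N :> nat ->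
  (marginal_mx R N *m x) r 0 = \sum_(j < N) x (pair_index j k) 0.
Proof.
move=> rk; rewrite mxE sum_pair_index; apply: eq_bigr => j _.
rewrite (bigD1 k) //= [X in _ + X]big1 ?addr0.
  by rewrite mxE rk ltnNge leq_addr /= modnMDl modn_small // addKn eqxx mul1r.
move=> i ik; rewrite mxE rk ltnNge leq_addr /= modnMDl modn_small // addKn.
by rewrite (negbTE (ik : (i : nat) != k)) mul0r.
Qed.

(* Main.v *)
Require Import Defs.
From mathcomp Require Import all_boot all_order all_algebra.
From mathcomp Require Import all_classical all_reals all_analysis.
From mathcomp Require Import ring lra.

Import Order.TTheory GRing.Theory Num.Theory.
Import numFieldNormedType.Exports.

Local Open Scope classical_set_scope.
Local Open Scope ring_scope.

(** The logistic form xi = a + (b - a) / (1 + e^((b - a) tau)) together with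
    cos^2 (atan u) = 1 / (1 + u^2) gives xi = (a + b) / 2 + (b - a) / 2 * cos h.
    Since |cos| <= 1, xi lies in [a, b]; since cos is 1-Lipschitz, xi is
    (b - a) / 2-Lipschitz as a function of h. The three norm estimates follow
    coordinatewise, the l1 one by Cauchy-Schwarz on N^2 coordinates. *)

(** The mean value theorem gives [cos u - cos v = - sin c * (u - v)], and [|sin c| <= 1]. *)
Lemma dist_cos_le (R : realType) (u v : R) : `|cos u - cos v| <= `|u - v|.
Proof.
wlog le_vu : u v / v <= u.
  by move=> H; case/orP: (le_total v u) => /H //; rewrite distrC (distrC u).
have [|c _ ->] := MVT_segment le_vu (fun x _ => is_derive_cos x).
  exact: (continuous_subspaceT (@continuous_cos R)).
by rewrite normrM normrN ler_piMl // sin_max.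
Qed.

Lemma xi_cos (R : realType) (a b tau : R) :
  xi a b tau = (a + b) / 2 + (b - a) / 2 * cos (h a b tau).
Proof.
(* The factor 2 in [h] calls for the double angle formula, cos h = 2 cos^2 (atan w) - 1. *)
rewrite /xi /h mulr_natl cos_mulr2n cos_atan.
set w := expR ((b - a) * tau / 2); set s := Num.sqrt _.
have sE : s ^+ 2 = 1 + w ^+ 2 by rewrite sqr_sqrtr // addr_ge0 // sqr_ge0.
(* Since w^2 = e^((b - a) tau), the common factor e^(-b tau) cancels in [xi], leaving a rational
   function of w^2. *)
have wE : expR (- a * tau) = expR (- b * tau) * w ^+ 2.
  by rewrite /w -expRM_natl -expRD; congr expR; field.
have e_gt0 := expR_gt0 (- b * tau).
have w2_ge0 : 0 <= w ^+ 2 := sqr_ge0 w.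
rewrite exprVn sE wE; field.
by apply/andP; split; apply: lt0r_neq0; nra.
Qed.

Lemma xi_itv (R : realType) (a b tau : R) : a <= b -> xi a b tau \in `[a, b].
Proof.
move=> le_ab; rewrite xi_cos in_itv /=.
have := cos_geN1 (h a b tau); have := cos_le1 (h a b tau).
by move: (cos _) => c c_le1 c_geN1; apply/andP; split; nra.
Qed.

Lemma dist_xi_le (R : realType) (a b tau sigma : R) : a <= b ->
  `|xi a b tau - xi a b sigma| <= (b - a) / 2 * `|h a b tau - h a b sigma|.
Proof.
move=> le_ab; rewrite !xi_cos opprD addrACA subrr add0r -mulrBr normrM.
have ba_ge0 : 0 <= (b - a) / 2 by lra.
by rewrite (ger0_norm ba_ge0) ler_wpM2l // dist_cos_le.
Qed.

(** A [sup] dominates its set only once an upper bound is exhibited; for a finite family the sum of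
    the absolute values is one. *)
Lemma ord_le_sup (R : realType) (m : nat) (F : 'I_m -> R) (n : 'I_m) :
  F n <= sup (range F).
Proof.
apply: ub_le_sup; last by exists n.
exists (\sum_i `|F i|) => _ [i _ <-].
by rewrite (bigD1 i) //= (le_trans (ler_norm _)) // lerDl sumr_ge0.
Qed.

(** Cauchy-Schwarz in variance form: with S the l1 norm, m times the sum of squares exceeds S^2 by m
    times the sum of the squared deviations of |x_n| from their mean S / m. *)
Lemma l1norm_le_l2norm (R : realType) (m : nat) (x : 'cV[R]_m) :
  l1norm x <= Num.sqrt m%:R * l2norm x.
Proof.
(* The empty case is split off so that the mean S / m makes sense. *)
case: m x => [|m] x; first by rewrite /l1norm big_ord0 mulr_ge0 // sqrtr_ge0.
rewrite -sqrtrM // -[leLHS]ger0_norm; last by rewrite sumr_ge0.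
rewrite -sqrtr_sqr ler_wsqrtr //.
set S := l1norm x; set Q := \sum_n _; set M : R := m.+1%:R.
have M_gt0 : 0 < M by rewrite ltr0n.
have -> : M * Q = S ^+ 2 + M * \sum_n (`|x n 0| - S / M) ^+ 2; last first.
  by rewrite lerDl mulr_ge0 ?(ltW M_gt0) // sumr_ge0 // => n _; rewrite sqr_ge0.
have -> : \sum_n (`|x n 0| - S / M) ^+ 2 = Q - S / M * 2 * S + M * (S / M) ^+ 2.
  move: (S / M) => t.
  have -> : M * t ^+ 2 = \sum_(n < m.+1) t ^+ 2.
    by rewrite sumr_const card_ord mulr_natl.
  rewrite mulr_sumr -sumrB -big_split /=.
  by apply: eq_bigr => n _; rewrite -(real_normK (num_real (x n 0))); ring.
by field; rewrite gt_eqF.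
Qed.

Theorem theorem3p4 (R : realType) (N : nat) (hN : (1 <= N)%N)
    (a b : 'I_(N ^ 2) -> R) (hab : forall n, a n < b n)
    (W : 'cV[R]_(N ^ 2)) :
  let A := transport_mx W in
  let L := sup (range (fun n => b n - a n)) in
  let x := xstar A a b in
  (forall lambda : 'cV[R]_(2 * N + 1),
     box_solution A a b (A *m xi_vec a b (A^T *m lambda)) (x lambda)) /\
  (forall lambda1 lambda2 : 'cV[R]_(2 * N + 1),
     [/\ l2norm (x lambda1 - x lambda2)
           <= L / 2 * dM a b (A^T *m lambda1) (A^T *m lambda2),
         N%:R^-1 * l1norm (x lambda1 - x lambda2)
           <= L / 2 * dM a b (A^T *m lambda1) (A^T *m lambda2) &
         sup (range (fun n => `|x lambda1 n 0 - x lambda2 n 0|))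
           <= L / 2 * sup (range (fun n =>
                `|h (a n) (b n) ((A^T *m lambda1) n 0)
                  - h (a n) (b n) ((A^T *m lambda2) n 0)|))]).
Proof.
move=> A L x.
have hab' n : a n <= b n := ltW (hab n).
(* An index exists because N >= 1; it yields L >= 0 and the nonemptiness of the range in the sup
   estimate. *)
have n0 : 'I_(N ^ 2) by apply: (@Ordinal _ 0); rewrite expn_gt0 hN.
have leL n : b n - a n <= L := ord_le_sup _ _ (fun n => b n - a n) n.
have L_ge0 : 0 <= L / 2.
  by rewrite divr_ge0 // (le_trans _ (leL n0)) // subr_ge0.
split=> [lambda|lambda1 lambda2].
  by split=> // n; rewrite mxE xi_itv.
have dist_x n : `|x lambda1 n 0 - x lambda2 n 0| <= L / 2 *
    `|h (a n) (b n) ((A^T *m lambda1) n 0)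
      - h (a n) (b n) ((A^T *m lambda2) n 0)|.
  rewrite !mxE (le_trans (dist_xi_le _ _ _ _ _ (hab' n))) //.
  by rewrite ler_wpM2r // ler_wpM2r.
have l2_le : l2norm (x lambda1 - x lambda2) <=
    L / 2 * dM a b (A^T *m lambda1) (A^T *m lambda2).
  (* L / 2 moves under the root as its square, so that the two sums compare term by term. *)
  rewrite -[L / 2]ger0_norm // -sqrtr_sqr -sqrtrM ?sqr_ge0 // ler_wsqrtr //.
  rewrite mulr_sumr ler_sum // => n _.
  have -> : (x lambda1 - x lambda2) n 0 = x lambda1 n 0 - x lambda2 n 0.
    by rewrite !mxE.
  rewrite -exprMn -[leLHS]real_normK ?num_real //
    -[leRHS]real_normK ?num_real //.
  by rewrite lerXn2r ?nnegrE // normrM (ger0_norm L_ge0).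
split=> //.
  apply: le_trans l2_le; rewrite ler_pdivrMl ?ltr0n //.
  apply: le_trans (l1norm_le_l2norm _ _ _) _.
  (* The Cauchy-Schwarz constant sqrt (N^2) is N, which the factor 1 / N absorbs exactly. *)
  by rewrite natrX sqrtr_sqr ger0_norm.
apply: ge_sup; first by exists (`|x lambda1 n0 0 - x lambda2 n0 0|), n0.
move=> _ [n _ <-]; apply: le_trans (dist_x n) _.
rewrite ler_wpM2l //.
exact: (ord_le_sup _ _ (fun n => `|h (a n) (b n) ((A^T *m lambda1) n 0)
  - h (a n) (b n) ((A^T *m lambda2) n 0)|) n).
Qed.
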